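(* Let $ABC$ be a nondegenerate triangle in the Euclidean plane. Let $D_{ABC}$ be the open disk bounded by the circumcircle $\omega_{ABC}$ of $ABC$. Let $\omega_{A,B}$ be the circle through $A$ and $C$ that is tangent to line $AB$ (at $A$), let $\omega_{A,C}$ be the circle through $A$ and $B$ that is tangent to line $AC$ (at $A$), and let $D_{A,B}$, $D_{A,C}$ be the closed disks bounded by $\omega_{A,B}$ and $\omega_{A,C}$ respectively. Then the locus of the Miquel–Steiner points $M_A$ of all pairs of internal cevians $BB_A, CC_A$ (that is, the set of all points $M_A$ obtained as $B_A$ ranges over the open segment $AC$ and $C_A$ ranges over the open segment $AB$) is exactly $$\Lambda_A = D_{ABC}\setminus\left(D_{A,B}\cup D_{A,C}\right).$$
   Context: Given a nondegenerate triangle $ABC$, cevians are lines $BB_A$ and $CC_A$ with $B_A$ on line $AC$ and $C_A$ on line $AB$. A cevian $BB_A$ is internal if $B_A$ lies strictly between $A$ and $C$; $CC_A$ is internal if $C_A$ lies strictly between $A$ and $B$. Let $N_A$ be the intersection point of $BB_A$ and $CC_A$. The circumcircles of the four triangles $ABB_A$, $ACC_A$, $CB_AN_A$, $BC_AN_A$ have a unique common point $M_A$, called the Miquel–Steiner point of triangle $ABC$ with cevians $BB_A, CC_A$ (equivalently, $M_A$ is the common point other than $A$ of the circumcircles of $ABB_A$ and $ACC_A$). *)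

(* Defs.v *)
From mathcomp Require Import all_boot all_order all_algebra.
From mathcomp Require Import classical_sets reals.

Set Implicit Arguments.
Unset Strict Implicit.
Unset Printing Implicit Defensive.

Import Order.TTheory GRing.Theory Num.Theory.

Local Open Scope classical_set_scope.
Local Open Scope ring_scope.

Notation plane R := 'rV[R]_2.

(* The library norm on row vectors is the sup norm, hence this definition. *)
Definition edist (R : realType) (P Q : plane R) : R :=
  Num.sqrt (\sum_(i < 2) (P 0 i - Q 0 i) ^+ 2).

(* A genuine line only when P != Q. *)
Definition line (R : realType) (P Q : plane R) : set (plane R) :=
  [set P + t *: (Q - P) | t in [set: R]].

Definition open_segment (R : realType) (P Q : plane R) : set (plane R) :=
  [set P + t *: (Q - P) | t in [set t : R | 0 < t < 1]].

Definition collinear (R : realType) (A B C : plane R) : Prop :=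
  exists P Q : plane R,
    [/\ P != Q, line P Q A, line P Q B & line P Q C].

Record circle (R : realType) := Circle {
  center : plane R;
  radius : R;
  radius_gt0 : 0 < radius }.

Definition circle_set (R : realType) (K : circle R) : set (plane R) :=
  [set P | edist P (center K) = radius K].

Definition open_disk (R : realType) (K : circle R) : set (plane R) :=
  [set P | edist P (center K) < radius K].

Definition closed_disk (R : realType) (K : circle R) : set (plane R) :=
  [set P | edist P (center K) <= radius K].

Definition is_circumcircle (R : realType) (K : circle R) (A B C : plane R) :
    Prop :=
  [/\ circle_set K A, circle_set K B & circle_set K C].

Definition tangent_at (R : realType) (K : circle R) (l : set (plane R))
    (P : plane R) : Prop :=
  circle_set K `&` l = [set P].

(* The cevians are B BA and C CA, with BA on line A C and CA on line A B. The
   last equation says that M is the unique common point of the four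
   circumcircles. *)
Definition is_miquel_steiner (R : realType) (A B C BA CA M : plane R) : Prop :=
  exists (N : plane R) (K1 K2 K3 K4 : circle R),
    line B BA `&` line C CA = [set N] /\
    [/\ is_circumcircle K1 A B BA, is_circumcircle K2 A C CA,
        is_circumcircle K3 C BA N & is_circumcircle K4 B CA N] /\
    circle_set K1 `&` circle_set K2 `&` circle_set K3 `&` circle_set K4
      = [set M].

Definition miquel_steiner_locus (R : realType) (A B C : plane R) :
    set (plane R) :=
  [set M | exists BA CA : plane R,
    [/\ open_segment A C BA, open_segment A B CA
      & is_miquel_steiner A B C BA CA M]].

(* Main.v *)
(** In the affine frame [X = A + x (B - A) + y (C - A)] let [n] be the quadratic
    form [|X - A|^2], and [p = |B - A|^2], [q = |C - A|^2].  The circle [ABC] is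
    [n = p x + q y], the two tangent circles are [n = q y] and [n = p x], and for
    [BA = (0, s)], [CA = (t, 0)] the circles through [A, B, BA] and [A, C, CA] are
    [n = p x + s q y] and [n = t p x + q y].  A point other than [A] on the last
    two circles determines [s = (n - p x) / (q y)] and [t = (n - q y) / (p x)], and
    [0 < s, t < 1] says exactly [p x < n], [q y < n] and [n < p x + q y]. *)
Require Import Defs.
From mathcomp Require Import all_boot all_order all_algebra.
From mathcomp Require Import classical_sets reals.
From mathcomp Require Import ring lra.

Set Implicit Arguments.
Unset Strict Implicit.
Unset Printing Implicit Defensive.

Import Order.TTheory GRing.Theory Num.Theory.

Local Open Scope classical_set_scope.
Local Open Scope ring_scope.

(** * Affine coordinates at [A] and the squared-distance form *)

Definition affine_pt (R : realType) (A B C : plane R) (x y : R) : plane R :=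
  A + x *: (B - A) + y *: (C - A).

Definition dot (R : realType) (u v : plane R) : R :=
  u 0 0 * v 0 0 + u 0 1 * v 0 1.

Definition det2 (R : realType) (u v : plane R) : R :=
  u 0 0 * v 0 1 - u 0 1 * v 0 0.

Definition qform (R : realType) (p r q x y : R) : R :=
  p * x ^+ 2 + 2 * r * x * y + q * y ^+ 2.

(** This is the form [n], the squared length of [x (B - A) + y (C - A)]; its coefficients are the
    Gram entries of the frame. *)
Definition frame_form (R : realType) (A B C : plane R) : R -> R -> R :=
  qform (dot (B - A) (B - A)) (dot (B - A) (C - A)) (dot (C - A) (C - A)).

Lemma plane_eqP (R : realType) (P Q : plane R) :
  P 0 0 = Q 0 0 -> P 0 1 = Q 0 1 -> P = Q.
Proof.
move=> h0 h1; apply/rowP => i.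
case: i => [[|[|//]]] h; [move: h0|move: h1];
  by congr (P 0 _ = Q 0 _); apply/val_inj.
Qed.

Lemma affine_pt_coord (R : realType) (A B C : plane R) x y i :
  affine_pt A B C x y 0 i =
    A 0 i + x * (B 0 i - A 0 i) + y * (C 0 i - A 0 i).
Proof. by rewrite /affine_pt !mxE. Qed.

Lemma affine_ptC (R : realType) (A B C : plane R) x y :
  affine_pt A B C x y = affine_pt A C B y x.
Proof. by rewrite /affine_pt addrAC. Qed.

Lemma affine_pt00 (R : realType) (A B C : plane R) : affine_pt A B C 0 0 = A.
Proof. by rewrite /affine_pt !scale0r !addr0. Qed.

Lemma affine_pt10 (R : realType) (A B C : plane R) : affine_pt A B C 1 0 = B.
Proof. by rewrite /affine_pt scale1r scale0r addr0 addrC subrK. Qed.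

Lemma affine_pt01 (R : realType) (A B C : plane R) : affine_pt A B C 0 1 = C.
Proof. by rewrite affine_ptC affine_pt10. Qed.

Lemma frame_formC (R : realType) (A B C : plane R) x y :
  frame_form A B C x y = frame_form A C B y x.
Proof. by rewrite /frame_form /qform /dot; ring. Qed.

Lemma edist_affine_pt (R : realType) (A B C : plane R) x y u v :
  edist (affine_pt A B C x y) (affine_pt A B C u v) =
    Num.sqrt (frame_form A B C (x - u) (y - v)).
Proof.
rewrite /edist big_ord_recl big_ord1 (_ : lift _ _ = 1); last exact/val_inj.
rewrite !affine_pt_coord /frame_form /qform /dot !mxE; congr Num.sqrt; ring.
Qed.

Lemma collinear_det2 (R : realType) (A B C : plane R) :
  det2 (B - A) (C - A) = 0 -> collinear A B C.
Proof.
have linel (P Q : plane R) : line P Q P by exists 0; rewrite // scale0r addr0.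
have liner (P Q : plane R) : line P Q Q.
  by exists 1; rewrite // scale1r addrC subrK.
move=> det0; have [BA|BA] := eqVneq B A.
  have [CA|CA] := eqVneq C A.
    (* All three points coincide, but a line needs two distinct points, so an arbitrary second point
       is supplied. *)
    exists A, (A + const_mx 1); rewrite BA CA; split=> //.
    rewrite eq_sym -subr_eq0 addrAC subrr add0r.
    by apply/eqP => /rowP/(_ 0)/eqP; rewrite !mxE oner_eq0.
  by exists A, C; rewrite BA; split=> //; rewrite eq_sym.
exists A, B; split; rewrite 1?eq_sym//.
have BB0 : dot (B - A) (B - A) != 0.
  apply: contra_neq BA => /eqP; rewrite /dot -!expr2.
  rewrite paddr_eq0 ?sqr_ge0// !sqrf_eq0 !mxE !subr_eq0.
  by case/andP=> /eqP h0 /eqP h1; apply: plane_eqP.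
(* The parameter of the orthogonal projection of [C] on line [AB]; the vanishing determinant makes
   [C] its own projection. *)
exists (dot (B - A) (C - A) / dot (B - A) (B - A)) => //.
move: det0 BB0; rewrite /det2 /dot !mxE => det0 BB0.
apply: plane_eqP; rewrite !mxE.
  apply: (mulfI BB0); rewrite mulrDr mulrA mulrCA divff// mulr1.
  set E1 := (X in X = 0) in det0.
  apply/eqP; rewrite -subr_eq0; apply/eqP.
  transitivity ((B 0 1 - A 0 1) * E1); last by rewrite det0 mulr0.
  by rewrite /E1; ring.
apply: (mulfI BB0); rewrite mulrDr mulrA mulrCA divff// mulr1.
set E1 := (X in X = 0) in det0.
apply/eqP; rewrite -subr_eq0; apply/eqP.
transitivity (- (B 0 0 - A 0 0) * E1); last by rewrite det0 mulr0.
by rewrite /E1; ring.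
Qed.

Definition nondegenerate (R : realType) (A B C : plane R) : Prop :=
  det2 (B - A) (C - A) != 0.

Lemma nondegenerateC (R : realType) (A B C : plane R) :
  nondegenerate A B C -> nondegenerate A C B.
Proof.
rewrite /nondegenerate.
have -> : det2 (C - A) (B - A) = - det2 (B - A) (C - A) by rewrite /det2; ring.
by rewrite oppr_eq0.
Qed.

(** Cramer's rule gives the coordinates. *)
Lemma affine_pt_surj (R : realType) (A B C : plane R) (X : plane R) :
  nondegenerate A B C -> exists x y, X = affine_pt A B C x y.
Proof.
move=> nd.
exists (det2 (X - A) (C - A) / det2 (B - A) (C - A)).
exists (det2 (B - A) (X - A) / det2 (B - A) (C - A)).
move: nd; rewrite /nondegenerate /det2 !mxE => nd.
by apply: plane_eqP; rewrite affine_pt_coord; field; exact: nd.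
Qed.

Lemma dot_gt0 (R : realType) (A B C : plane R) :
  nondegenerate A B C -> 0 < dot (B - A) (B - A).
Proof.
move=> nd; rewrite lt_neqAle addr_ge0 -?expr2 ?sqr_ge0// andbT eq_sym.
apply: contra_neq nd => /eqP; rewrite /dot /det2 -!expr2.
rewrite paddr_eq0 ?sqr_ge0// !sqrf_eq0.
by case/andP=> /eqP -> /eqP ->; rewrite !mul0r subrr.
Qed.

(** By Lagrange's identity the Gram determinant is the square of [det2]. *)
Lemma gram_gt0 (R : realType) (A B C : plane R) : nondegenerate A B C ->
  0 < dot (B - A) (B - A) * dot (C - A) (C - A) - dot (B - A) (C - A) ^+ 2.
Proof.
move=> nd; rewrite (_ : _ - _ = det2 (B - A) (C - A) ^+ 2).
  by rewrite lt_neqAle sqr_ge0 andbT eq_sym sqrf_eq0.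
by rewrite /dot /det2; ring.
Qed.

(** Completing the square: [p n = (p x + r y)^2 + (p q - r^2) y^2]. Assuming only [<= 0] lets the
    same lemma also give nonnegativity of the form. *)
Lemma frame_form_eq0 (R : realType) (A B C : plane R) x y :
  nondegenerate A B C -> frame_form A B C x y <= 0 -> x = 0 /\ y = 0.
Proof.
move=> nd; have p0 := dot_gt0 nd; have g0 := gram_gt0 nd.
rewrite /frame_form /qform.
move: (dot (B - A) (B - A)) (dot (B - A) (C - A)) (dot (C - A) (C - A)) p0 g0 => p r q p0 g0 n0.
have E : (p * x + r * y) ^+ 2 + (p * q - r ^+ 2) * y ^+ 2 <= 0.
  rewrite (_ : _ + _ = p * (p * x ^+ 2 + 2 * r * x * y + q * y ^+ 2)).
    by rewrite pmulr_rle0.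
  by ring.
have h1 := sqr_ge0 (p * x + r * y); have h2 := mulr_ge0 (ltW g0) (sqr_ge0 y).
have y0 : y = 0.
  have /eqP : (p * q - r ^+ 2) * y ^+ 2 = 0 by apply/le_anti; lra.
  by rewrite mulf_eq0 gt_eqF//= sqrf_eq0 => /eqP.
split=> //; have /eqP : (p * x + r * y) ^+ 2 = 0 by apply/le_anti; lra.
by rewrite y0 mulr0 addr0 sqrf_eq0 mulf_eq0 gt_eqF//= => /eqP.
Qed.

Lemma frame_form_ge0 (R : realType) (A B C : plane R) x y :
  nondegenerate A B C -> 0 <= frame_form A B C x y.
Proof.
move=> nd; case: (leP 0 (frame_form A B C x y)) => // n0.
have [x0 y0] := frame_form_eq0 nd (ltW n0).
by move: n0; rewrite x0 y0 /frame_form /qform; lra.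
Qed.

Lemma affine_pt_inj (R : realType) (A B C : plane R) x y u v :
  nondegenerate A B C ->
  affine_pt A B C x y = affine_pt A B C u v -> x = u /\ y = v.
Proof.
move=> nd E; have /eqP : edist (affine_pt A B C x y) (affine_pt A B C u v) = 0.
  by rewrite E edist_affine_pt !subrr /frame_form /qform
    !(expr0n, mulr0, addr0) sqrtr0.
rewrite edist_affine_pt sqrtr_eq0 => /(frame_form_eq0 nd)[].
by move=> /subr0_eq-> /subr0_eq->.
Qed.

(** * Equations of circles in the affine frame *)

(** The left side is the power of the point with respect to [K], so its sign separates circle, open
    disk and exterior. *)
Definition circle_eqn (R : realType) (A B C : plane R) (K : circle R)
    (a d k : R) : Prop :=
  forall x y, edist (affine_pt A B C x y) (center K) ^+ 2 - radius K ^+ 2 =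
    frame_form A B C x y - (a * x + d * y + k).

Lemma edist_ge0 (R : realType) (P Q : plane R) : 0 <= edist P Q.
Proof. exact: sqrtr_ge0. Qed.

Section Equations.
Context (R : realType) (A B C : plane R).
Implicit Types (K : circle R) (a d k x y s t : R).

Lemma circle_eqn_on K a d k x y : circle_eqn A B C K a d k ->
  circle_set K (affine_pt A B C x y) <->
    frame_form A B C x y = a * x + d * y + k.
Proof.
move=> KE; have := KE x y; rewrite /circle_set/=; split=> [E|E].
  by apply/eqP; rewrite -subr_eq0 -KE E subrr.
apply/eqP; rewrite -(eqrXn2 (n := 2))// ?edist_ge0 ?ltW ?radius_gt0//.
by rewrite -subr_eq0 KE E subrr.
Qed.

Lemma circle_eqn_open K a d k x y : circle_eqn A B C K a d k ->
  open_disk K (affine_pt A B C x y) <->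
    frame_form A B C x y < a * x + d * y + k.
Proof.
move=> KE; rewrite -subr_lt0 -KE subr_lt0 ltr_pXn2r//.
  by rewrite nnegrE edist_ge0.
by rewrite nnegrE ltW ?radius_gt0.
Qed.

Lemma circle_eqn_closed K a d k x y : circle_eqn A B C K a d k ->
  closed_disk K (affine_pt A B C x y) <->
    frame_form A B C x y <= a * x + d * y + k.
Proof.
move=> KE; rewrite -subr_le0 -KE subr_le0 ler_pXn2r//.
  by rewrite nnegrE edist_ge0.
by rewrite nnegrE ltW ?radius_gt0.
Qed.

Lemma circle_eqnC K a d k : circle_eqn A B C K a d k -> circle_eqn A C B K d a k.
Proof.
by move=> KE x y; rewrite affine_ptC KE frame_formC [a * _ + _]addrC.
Qed.

Hypothesis nd : nondegenerate A B C.
Let p := dot (B - A) (B - A).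
Let r := dot (B - A) (C - A).
Let q := dot (C - A) (C - A).

Lemma circle_eqn_ex K : exists a d k, circle_eqn A B C K a d k.
Proof.
have [u [v E]] := affine_pt_surj (center K) nd.
exists (2 * (p * u + r * v)), (2 * (r * u + q * v)).
exists (radius K ^+ 2 - frame_form A B C u v) => x y.
rewrite E edist_affine_pt sqr_sqrtr ?frame_form_ge0//.
by rewrite /frame_form /qform -/p -/q -/r; ring.
Qed.

(** Completing the square produces a centre and a squared radius. One solution makes the squared
    radius nonnegative; a second one rules out a circle shrunk to its centre. *)
Lemma circle_of_eqn a d k x y u v :
  (x, y) <> (u, v) ->
  frame_form A B C x y = a * x + d * y + k ->
  frame_form A B C u v = a * u + d * v + k ->
  exists K, circle_eqn A B C K a d k.
Proof.
move=> xyuv E1 E2; have D0 := gram_gt0 nd; rewrite -/p -/q -/r in D0.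
pose D := p * q - r ^+ 2.
(* The centre solves [p w + r z = a / 2] and [r w + q z = d / 2], which cancels the linear terms. *)
pose w := (a * q - d * r) / (2 * D); pose z := (d * p - a * r) / (2 * D).
pose ctr := affine_pt A B C w z.
have shift x' y' : frame_form A B C (x' - w) (y' - z) =
    frame_form A B C x' y' - (a * x' + d * y' + k)
    + (k + frame_form A B C w z).
  rewrite /frame_form /qform -/p -/q -/r /w /z /D; field.
  by rewrite gt_eqF.
have rho0 : 0 < k + frame_form A B C w z.
  have h1 := shift x y; have h2 := shift u v.
  rewrite E1 subrr add0r in h1; rewrite E2 subrr add0r in h2.
  rewrite lt_neqAle -{2}h1 frame_form_ge0// andbT eq_sym.
  apply: contra_not_neq xyuv => rho0; move: h1 h2; rewrite rho0.
  have ctr0 x' y' : frame_form A B C (x' - w) (y' - z) = 0 -> (x', y') = (w, z).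
    move=> E; have []// := @frame_form_eq0 _ A B C (x' - w) (y' - z) nd.
      by rewrite E.
    by move=> /subr0_eq-> /subr0_eq->.
  by move=> /ctr0-> /ctr0->.
have srho0 : 0 < Num.sqrt (k + frame_form A B C w z) by rewrite sqrtr_gt0.
exists (Circle ctr srho0) => x' y' /=.
by rewrite edist_affine_pt !sqr_sqrtr ?frame_form_ge0 ?ltW// shift; ring.
Qed.

(** * Circles through [A], and chords on line [AC] *)

(** The three points fix [k], [a] and [d] in turn. The case [s = 1] is the circumcircle of [ABC]. *)
Lemma circle_eqn_circum K s : s != 0 ->
  is_circumcircle K A B (affine_pt A B C 0 s) <->
    circle_eqn A B C K p (s * q) 0.
Proof.
move=> s0; split=> [[]|KE].
  have [a [d [k KE]]] := circle_eqn_ex K.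
  rewrite -{1}(affine_pt00 A B C) -{2}(affine_pt10 A B C).
  rewrite !(circle_eqn_on _ _ KE) /frame_form /qform -/p -/q -/r => h0 h1 hs.
  have k0 : k = 0 by lra.
  have a0 : a = p by lra.
  have d0 : d = s * q by apply: (mulIf s0); lra.
  by rewrite -k0 -a0 -d0.
split; [rewrite -{1}(affine_pt00 A B C)|rewrite -{1}(affine_pt10 A B C)|];
  by rewrite (circle_eqn_on _ _ KE) /frame_form /qform -/p -/q -/r; ring.
Qed.

(** On line [AB] a circle through [A] reads [x (p x - a) = 0]. Its other root [a / p] must be [0] by
    tangency, and [C] then gives [d = q]. *)
Lemma circle_eqn_tangent K : circle_set K A -> circle_set K C ->
  tangent_at K (line A B) A -> circle_eqn A B C K 0 q 0.
Proof.
have [a [d [k KE]]] := circle_eqn_ex K.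
rewrite -{1}(affine_pt00 A B C) -{2}(affine_pt01 A B C).
rewrite !(circle_eqn_on _ _ KE) /frame_form /qform -/p -/q -/r => h0 h1 tan.
have p0 : 0 < p := dot_gt0 nd.
have k0 : k = 0 by lra.
have : (circle_set K `&` line A B) (affine_pt A B C (a / p) 0).
  split; last by exists (a / p); rewrite // /affine_pt scale0r addr0.
  rewrite (circle_eqn_on _ _ KE) /frame_form /qform -/p -/q -/r k0.
  by field; rewrite gt_eqF.
rewrite tan /= -{2}(affine_pt00 A B C) => /(affine_pt_inj nd)[/eqP].
rewrite mulf_eq0 invr_eq0 (gt_eqF p0) orbF => /eqP a0 _.
have d0 : d = q by lra.
by move: KE; rewrite a0 d0 k0.
Qed.

(** A circle meets line [AC] at most twice. This keeps [A] off the circle through [C], [BA] and [N],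
    hence out of the common points. *)
Lemma circle_chord_notin K s : s != 0 -> s != 1 ->
  circle_set K C -> circle_set K (affine_pt A B C 0 s) -> ~ circle_set K A.
Proof.
move=> s0 s1; have [a [d [k KE]]] := circle_eqn_ex K.
rewrite -{1}(affine_pt01 A B C) => hC hs; rewrite -{1}(affine_pt00 A B C) => hA.
move: hC hs hA.
rewrite !(circle_eqn_on _ _ KE) /frame_form /qform -/p -/q -/r => h1 hs h0.
have q0 : q != 0 by rewrite gt_eqF// (dot_gt0 (nondegenerateC nd)).
suff : q * s * (s - 1) = 0.
  by apply/eqP; rewrite !mulf_neq0// subr_eq0.
have k0 : k = 0 by lra.
have dq : d = q by lra.
by move: hs; rewrite k0 dq; lra.
Qed.

(** * The Miquel configuration *)

(** Miquel's theorem by computation, for the circle at [C]. Exchanging [B] and [C] yields the circle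
    at [B]. *)
Lemma circle_third s t x y K1 K2 :
  0 < s < 1 -> 0 < t < 1 -> 0 < x -> 0 < y ->
  circle_eqn A B C K1 p (s * q) 0 -> circle_eqn A B C K2 (t * p) q 0 ->
  circle_set K1 (affine_pt A B C x y) -> circle_set K2 (affine_pt A B C x y) ->
  exists K, is_circumcircle K C (affine_pt A B C 0 s)
      (affine_pt A B C (t * (1 - s) / (1 - s * t)) (s * (1 - t) / (1 - s * t)))
    /\ circle_set K (affine_pt A B C x y).
Proof.
move=> /andP[s0 s1] /andP[t0 t1] x0 y0 E1 E2.
rewrite (circle_eqn_on _ _ E1) (circle_eqn_on _ _ E2) => M1 M2.
have st1 : 0 < 1 - s * t by nra.
set u := t * (1 - s) / (1 - s * t); set v := s * (1 - t) / (1 - s * t).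
have u0 : 0 < u by rewrite divr_gt0// mulr_gt0// subr_gt0.
(* On [x = 0] the equation must be [q (y - 1) (y - s) = 0], so [d = q (1 + s)] and [k = - s q]. The
   free coefficient [a] is chosen to pass through the meeting point [(u, v)] of the cevians. *)
pose a := (frame_form A B C u v - q * (1 + s) * v + s * q) / u.
have onC : frame_form A B C 0 1 = a * 0 + q * (1 + s) * 1 + - (s * q).
  by rewrite /frame_form /qform -/p -/q -/r; ring.
have onS : frame_form A B C 0 s = a * 0 + q * (1 + s) * s + - (s * q).
  by rewrite /frame_form /qform -/p -/q -/r; ring.
have onN : frame_form A B C u v = a * u + q * (1 + s) * v + - (s * q).
  by rewrite /a divfK ?gt_eqF//; ring.
have CS : (0, 1) <> (0, s) :> R * R by case=> s1'; move: s1; rewrite -s1' ltxx.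
have [K KE] := circle_of_eqn CS onC onS.
exists K; split.
  split; [rewrite -{1}(affine_pt01 A B C)| |]; exact/(circle_eqn_on _ _ KE).
apply/(circle_eqn_on _ _ KE).
rewrite M1 /a /frame_form /qform -/p -/q -/r.
(* Eliminating [p] and [r] by the two circles through the point leaves an
   identity of rational functions in the free variables [s, t, q, x, y]. *)
have pE : p = (1 - s) * q * y / ((1 - t) * x).
  have tx : (1 - t) * x != 0 by rewrite mulf_neq0 ?gt_eqF ?subr_gt0.
  by apply: (mulIf tx); rewrite divfK//; lra.
have rE : r = (p * x + s * q * y - p * x ^+ 2 - q * y ^+ 2) / (2 * x * y).
  have xy : 2 * x * y != 0 by rewrite !mulf_neq0 ?gt_eqF.
  apply: (mulIf xy); rewrite divfK//.
  by move: M1; rewrite /frame_form /qform -/p -/q -/r; lra.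
rewrite rE pE /u /v; field.
by rewrite (gt_eqF st1) !gt_eqF ?subr_gt0.
Qed.

(** Subtracting the equations gives [(1 - t) p x = (1 - s) q y], so [x] and [y] have the same sign;
    were both nonpositive, the positive form would equal a nonpositive number. *)
Lemma second_point_gt0 s t x y : 0 < s < 1 -> 0 < t < 1 ->
  frame_form A B C x y = p * x + s * q * y ->
  frame_form A B C x y = t * p * x + q * y ->
  affine_pt A B C x y <> A -> 0 < x /\ 0 < y.
Proof.
move=> /andP[s0 s1] /andP[t0 t1] E1 E2 MA.
have n0 : 0 < frame_form A B C x y.
  rewrite ltNge; apply/negP => /(frame_form_eq0 nd)[x0 y0].
  by apply: MA; rewrite x0 y0 affine_pt00.
have p0 : 0 < p := dot_gt0 nd.
have q0 : 0 < q := dot_gt0 (nondegenerateC nd).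
have E : (1 - t) * p * x = (1 - s) * q * y by lra.
have sq0 : 0 < (1 - s) * q by rewrite mulr_gt0// subr_gt0.
have tp0 : 0 < (1 - t) * p by rewrite mulr_gt0// subr_gt0.
have xy : (0 < x) = (0 < y).
  by rewrite -(pmulr_rgt0 x tp0) E (pmulr_rgt0 y sq0).
suff y0 : 0 < y by rewrite xy.
rewrite ltNge; apply/negP => y0.
have x0 : x <= 0 by rewrite leNgt xy -leNgt.
have := mulr_ge0_le0 (ltW p0) x0.
have := mulr_ge0_le0 (ltW (mulr_gt0 s0 q0)) y0.
by lra.
Qed.

(** Both points lie on the radical axis through [A], so [(u, v) = l (x, y)]. *)
Lemma second_point_uniq s t x y u v : 0 < s < 1 -> 0 < t < 1 ->
  frame_form A B C x y = p * x + s * q * y ->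
  frame_form A B C x y = t * p * x + q * y ->
  frame_form A B C u v = p * u + s * q * v ->
  frame_form A B C u v = t * p * u + q * v ->
  affine_pt A B C x y <> A -> affine_pt A B C u v <> A ->
  affine_pt A B C u v = affine_pt A B C x y.
Proof.
move=> s01 t01 E1 E2 F1 F2 MA NA.
have [x0 y0] := second_point_gt0 s01 t01 E1 E2 MA.
have [u0 v0] := second_point_gt0 s01 t01 F1 F2 NA.
have q0 : 0 < q := dot_gt0 (nondegenerateC nd).
have p0 : 0 < p := dot_gt0 nd.
case/andP: s01 => s0 s1; case/andP: t01 => t0 t1.
pose l := u / x.
have uE : u = l * x by rewrite /l divfK ?gt_eqF.
have vE : v = l * y.
  have sq0 : (1 - s) * q != 0 by rewrite gt_eqF// mulr_gt0// subr_gt0.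
  apply: (mulfI sq0).
  have -> : (1 - s) * q * v = (1 - t) * p * u by lra.
  have -> : (1 - s) * q * (l * y) = l * ((1 - s) * q * y) by ring.
  have -> : (1 - s) * q * y = (1 - t) * p * x by lra.
  by rewrite uE; ring.
(* The form scales by [l^2] and the linear side by [l], so [l^2 = l] with [l] nonzero. *)
have l1 : l = 1.
  have n0 : p * x + s * q * y != 0 by rewrite gt_eqF// addr_gt0 ?mulr_gt0.
  have l0 : l != 0 by rewrite mulf_neq0 ?invr_eq0 ?gt_eqF.
  apply: (mulfI (mulf_neq0 l0 n0)); rewrite mulr1.
  transitivity (frame_form A B C u v); last by rewrite F1 uE vE; ring.
  by rewrite -E1 /frame_form /qform uE vE; ring.
by rewrite uE vE l1 !mul1r.
Qed.

(** Equating [(1 - z, z s)] with [(w t, 1 - w)] is a linear system of determinant [1 - s t], nonzero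
    for internal cevians. *)
Lemma cevians_meet s t : 0 < s < 1 -> 0 < t < 1 ->
  line B (affine_pt A B C 0 s) `&` line C (affine_pt A B C t 0) =
  [set affine_pt A B C (t * (1 - s) / (1 - s * t)) (s * (1 - t) / (1 - s * t))].
Proof.
move=> /andP[s0 s1] /andP[t0 t1].
have st1 : 1 - s * t != 0 by rewrite gt_eqF//; nra.
have lineB z : B + z *: (affine_pt A B C 0 s - B) =
    affine_pt A B C (1 - z) (z * s).
  by apply: plane_eqP; rewrite !(affine_pt_coord, mxE); ring.
have lineC z : C + z *: (affine_pt A B C t 0 - C) =
    affine_pt A B C (z * t) (1 - z).
  by apply: plane_eqP; rewrite !(affine_pt_coord, mxE); ring.
apply/seteqP; split=> [X [[z _ <-] [w _]]|_ ->].
  rewrite lineB lineC => /(affine_pt_inj nd)[zw wz] /=.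
  have -> : z = (1 - t) / (1 - s * t).
    apply: (mulIf st1); rewrite divfK//.
    have wE : w = 1 - z * s by lra.
    by move: zw; rewrite wE; lra.
  by congr affine_pt; field.
split.
  by exists ((1 - t) / (1 - s * t)) => //; rewrite lineB; congr affine_pt; field.
by exists ((1 - s) / (1 - s * t)) => //; rewrite lineC; congr affine_pt; field.
Qed.

End Equations.

(** * The locus as a set of strict inequalities *)

Theorem theorem1 (R : realType) (A B C : plane R)
    (ABC_nondegenerate : ~ collinear A B C)
    (wABC wAB wAC : circle R)
    (wABC_circum : is_circumcircle wABC A B C)
    (wAB_A : circle_set wAB A) (wAB_C : circle_set wAB C)
    (wAB_tangent : tangent_at wAB (line A B) A)
    (wAC_A : circle_set wAC A) (wAC_B : circle_set wAC B)
    (wAC_tangent : tangent_at wAC (line A C) A) :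
  miquel_steiner_locus A B C =
    open_disk wABC `\` (closed_disk wAB `|` closed_disk wAC).
Proof.
have nd : nondegenerate A B C by apply/eqP => /collinear_det2.
have nd' := nondegenerateC nd.
have p0 := dot_gt0 nd; have q0 := dot_gt0 nd'.
have ABC_E : circle_eqn A B C wABC (dot (B - A) (B - A))
    (1 * dot (C - A) (C - A)) 0.
  by apply/(circle_eqn_circum nd _ (oner_neq0 R)); rewrite affine_pt01.
(* The second tangent circle comes from the first by exchanging [B] and [C]. *)
have AB_E := circle_eqn_tangent nd wAB_A wAB_C wAB_tangent.
have AC_E := circle_eqnC (circle_eqn_tangent nd' wAC_A wAC_B wAC_tangent).
have ABs_E K s : 0 < s -> is_circumcircle K A B (affine_pt A B C 0 s) <->
    circle_eqn A B C K (dot (B - A) (B - A)) (s * dot (C - A) (C - A)) 0.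
  by move=> s0; apply: circle_eqn_circum; rewrite // gt_eqF.
have ACt_E K t : 0 < t -> is_circumcircle K A C (affine_pt A B C t 0) <->
    circle_eqn A B C K (t * dot (B - A) (B - A)) (dot (C - A) (C - A)) 0.
  move=> t0; rewrite affine_ptC circle_eqn_circum ?gt_eqF//.
  by split=> /circle_eqnC.
have segAC s : A + s *: (C - A) = affine_pt A B C 0 s.
  by rewrite /affine_pt scale0r addr0.
have segAB t : A + t *: (B - A) = affine_pt A B C t 0.
  by rewrite /affine_pt scale0r addr0.
apply/seteqP; split=> M.
  move=> [_ [_ [[s /= s01 <-] [t /= t01 <-]]]].
  rewrite segAC segAB => -[N [K1 [K2 [K3 [K4 [_ [[K1c K2c [K3C K3s _] _] KM]]]]]]].
  have /andP[s0 s1] := s01; have /andP[t0 t1] := t01.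
  have [[[M1 M2] M3] _] : (circle_set K1 `&` circle_set K2 `&` circle_set K3
      `&` circle_set K4) M by rewrite KM.
  (* The third circle already meets line [AC] at [C] and [BA], so it misses [A]. *)
  have MA : M <> A.
    move=> MA; apply: (circle_chord_notin nd _ _ K3C K3s); rewrite -?MA//.
      by rewrite gt_eqF.
    by rewrite lt_eqF.
  move: M1 M2 MA; have [x [y ->]] := affine_pt_surj M nd.
  rewrite (circle_eqn_on _ _ (iffLR (ABs_E _ _ s0) K1c)).
  rewrite (circle_eqn_on _ _ (iffLR (ACt_E _ _ t0) K2c)) !addr0 => M1 M2 MA.
  have [x0 y0] := second_point_gt0 nd s01 t01 M1 M2 MA.
  have qy : 0 < dot (C - A) (C - A) * y by rewrite mulr_gt0.
  have px : 0 < dot (B - A) (B - A) * x by rewrite mulr_gt0.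
  split.
    by apply/(circle_eqn_open _ _ ABC_E); rewrite M1 addr0; nra.
  case=> [/(circle_eqn_closed _ _ AB_E)|/(circle_eqn_closed _ _ AC_E)];
    by rewrite M1; nra.
move=> []; have [x [y ->]] := affine_pt_surj M nd.
move=> /(circle_eqn_open _ _ ABC_E).
rewrite mul1r addr0 => nABC nU.
have nAB : dot (C - A) (C - A) * y < frame_form A B C x y.
  rewrite ltNge; apply/negP => h; apply: nU; left.
  by apply/(circle_eqn_closed _ _ AB_E); lra.
have nAC : dot (B - A) (B - A) * x < frame_form A B C x y.
  rewrite ltNge; apply/negP => h; apply: nU; right.
  by apply/(circle_eqn_closed _ _ AC_E); lra.
(* From [q y < n < p x + q y] follows [p x > 0], and likewise [q y > 0], so the quotients below have
   positive denominators. *)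
have px : 0 < dot (B - A) (B - A) * x by lra.
have qy : 0 < dot (C - A) (C - A) * y by lra.
have x0 : 0 < x by rewrite -(pmulr_rgt0 _ p0).
have y0 : 0 < y by rewrite -(pmulr_rgt0 _ q0).
pose s := (frame_form A B C x y - dot (B - A) (B - A) * x)
  / (dot (C - A) (C - A) * y).
pose t := (frame_form A B C x y - dot (C - A) (C - A) * y)
  / (dot (B - A) (B - A) * x).
have s01 : 0 < s < 1.
  by rewrite divr_gt0 ?subr_gt0//= ltr_pdivrMr// mul1r; lra.
have t01 : 0 < t < 1.
  by rewrite divr_gt0 ?subr_gt0//= ltr_pdivrMr// mul1r; lra.
have sE : s * dot (C - A) (C - A) * y
    = frame_form A B C x y - dot (B - A) (B - A) * x.
  by rewrite -mulrA divfK// gt_eqF.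
have tE : t * dot (B - A) (B - A) * x
    = frame_form A B C x y - dot (C - A) (C - A) * y.
  by rewrite -mulrA divfK// gt_eqF.
have M1 : frame_form A B C x y
    = dot (B - A) (B - A) * x + s * dot (C - A) (C - A) * y by lra.
have M2 : frame_form A B C x y
    = t * dot (B - A) (B - A) * x + dot (C - A) (C - A) * y by lra.
clearbody s t => {sE tE}.
have /andP[s0 s1] := s01; have /andP[t0 t1] := t01.
have O00 a d : frame_form A B C 0 0 = a * 0 + d * 0 + 0.
  by rewrite /frame_form /qform; ring.
have MA : affine_pt A B C x y <> A.
  by rewrite -{2}(affine_pt00 A B C) => /(affine_pt_inj nd)[xE]; lra.
have xy0 : (x, y) <> (0, 0) by case; lra.
(* [A] and [M] are the two distinct solutions that make each equation a genuine circle. *)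
have [K1 K1E] : exists K, circle_eqn A B C K (dot (B - A) (B - A))
    (s * dot (C - A) (C - A)) 0.
  by apply: (circle_of_eqn nd xy0 _ (O00 _ _)); rewrite addr0.
have [K2 K2E] : exists K, circle_eqn A B C K (t * dot (B - A) (B - A))
    (dot (C - A) (C - A)) 0.
  by apply: (circle_of_eqn nd xy0 _ (O00 _ _)); rewrite addr0.
have M1' : circle_set K1 (affine_pt A B C x y).
  by apply/(circle_eqn_on _ _ K1E); rewrite addr0.
have M2' : circle_set K2 (affine_pt A B C x y).
  by apply/(circle_eqn_on _ _ K2E); rewrite addr0.
have [K3 [K3c K3M]] := circle_third nd s01 t01 x0 y0 K1E K2E M1' M2'.
have [K4 [K4c K4M]] : exists K,
    is_circumcircle K B (affine_pt A B C t 0)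
      (affine_pt A B C (t * (1 - s) / (1 - s * t)) (s * (1 - t) / (1 - s * t)))
    /\ circle_set K (affine_pt A B C x y).
  (* Exchanging [B] with [C], [s] with [t] and [x] with [y] turns the fourth circle into the
     third. *)
  rewrite !(affine_ptC A B C) (mulrC s t).
  apply: (circle_third nd' t01 s01 y0 x0 (circle_eqnC K2E) (circle_eqnC K1E));
    by rewrite -affine_ptC.
exists (affine_pt A B C 0 s), (affine_pt A B C t 0); split.
- by exists s; rewrite ?segAC.
- by exists t; rewrite ?segAB.
exists (affine_pt A B C (t * (1 - s) / (1 - s * t)) (s * (1 - t) / (1 - s * t))).
exists K1, K2, K3, K4; split; first exact: cevians_meet.
split; first by split=> //; [exact/ABs_E|exact/ACt_E].
apply/seteqP; split=> [X [[[X1 X2] X3] _]|_ ->]; last by [].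
(* The first two circles also share [A]; the third one excludes it, leaving only their second
   intersection. *)
have XA : X <> A.
  case: K3c => K3C K3s _ XA.
  apply: (circle_chord_notin nd _ _ K3C K3s); rewrite -?XA//.
    by rewrite gt_eqF.
  by rewrite lt_eqF.
move: X1 X2 XA; have [u [v ->]] := affine_pt_surj X nd.
rewrite (circle_eqn_on _ _ K1E) (circle_eqn_on _ _ K2E) !addr0 => X1 X2 XA.
exact: (second_point_uniq nd s01 t01 M1 M2 X1 X2 MA XA).
Qed.
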